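(* Let $1\le k\le n$ be integers, let $\rho\in M_n^+$ be a mixed quantum state, and let $P$ be the orthogonal projection onto $\mathrm{range}(\rho)$. Then $D_{k\text{-coh}}(\rho)=1$ if and only if the operator norm of every $k\times k$ principal submatrix of $P$ is at most $1/2$.
   Context: $M_n^+$ is the set of $n\times n$ complex (Hermitian) positive semidefinite matrices. A mixed quantum state is a positive semidefinite matrix of trace $1$. The operator norm is the largest singular value; the trace norm $\|A\|_{\mathrm{tr}}$ is the sum of the singular values of $A$. For $1\le k\le n$, $C_{k\text{-coh}}\subseteq M_n^+$ is the set of all finite sums $\sum_j \mathbf{v}_j\mathbf{v}_j^*$ where each $\mathbf{v}_j\in\mathbb{C}^n$ has at most $k$ non-zero entries. The modified trace distance of $k$-coherence is $$D_{k\text{-coh}}(\rho)=\min\{\|\rho-X\|_{\mathrm{tr}} : X\in C_{k\text{-coh}}\}.$$ *)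

(* Defs.v *)
From HB Require Import structures.
From mathcomp Require Import all_boot all_order all_algebra.
From mathcomp Require Import complex.
From mathcomp Require Import boolp classical_sets reals.

Set Implicit Arguments.
Unset Strict Implicit.
Unset Printing Implicit Defensive.

Import Order.TTheory GRing.Theory Num.Theory.
Local Open Scope ring_scope.
Local Open Scope complex_scope.
Local Open Scope sesquilinear_scope.
Local Open Scope classical_set_scope.

Definition psdmx (R : realType) (n : nat) (A : 'M[R[i]]_n) : Prop :=
  A \is hermsymmx /\ forall v : 'cV[R[i]]_n, 0 <= (v ^t* *m A *m v) 0 0.

Definition mixed_state (R : realType) (n : nat) (rho : 'M[R[i]]_n) : Prop :=
  psdmx rho /\ \tr rho = 1.

(* Square roots of the eigenvalues, with multiplicity and in no particular
   order, of the Hermitian matrix A^* A. These eigenvalues are nonnegative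
   reals, so taking their real part loses nothing. *)
Definition singval (R : realType) (n : nat) (A : 'M[R[i]]_n) (i : 'I_n) : R :=
  Num.sqrt (complex.Re (spectral_diag (A ^t* *m A) 0 i)).

Definition opnorm (R : realType) (n : nat) (A : 'M[R[i]]_n) : R :=
  \big[Num.max/0]_(i < n) singval A i.

Definition trnorm (R : realType) (n : nat) (A : 'M[R[i]]_n) : R :=
  \sum_(i < n) singval A i.

Definition nnz (R : realType) (n : nat) (v : 'cV[R[i]]_n) : nat :=
  #|[pred a : 'I_n | v a 0 != 0]|.

Definition coh_cone (R : realType) (n k : nat) : set 'M[R[i]]_n :=
  [set X | exists (m : nat) (v : 'I_m -> 'cV[R[i]]_n),
     (forall j, (nnz (v j) <= k)%N) /\
     X = \sum_(j < m) v j *m (v j) ^t*].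

(* The least element of S; the value 0 is a placeholder when there is none. *)
Definition minimum (R : realType) (S : set R) : R :=
  xget 0 [set d | S d /\ lbound S d].

(* The cone is closed, so the minimum is attained. *)
Definition coh_dist (R : realType) (n k : nat) (rho : 'M[R[i]]_n) : R :=
  minimum [set trnorm (rho - X) | X in @coh_cone R n k].

(* MathComp's matrix spaces are row spaces, whence the transposes: the range
   is the column space. *)
Definition orthoproj_range (R : realType) (n : nat) (P A : 'M[R[i]]_n) : Prop :=
  [/\ P *m P = P, P ^t* = P & (P^T == A^T)%MS].

(* Main.v *)
(* Testing the distance against X = 0 gives D <= 1, so D = 1 means that
   |rho - X|_tr >= 1 for every X in the cone.

   If every k x k block of P has norm at most 1/2, then W = 2 P - 1 is a
   contraction with v^* W v <= 0 for every v with at most k nonzero entries, so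
   |rho - X|_tr >= tr (W (rho - X)) >= tr (W rho) = 1.

   Otherwise some v with at most k nonzero entries splits as p + q, with p = P v
   longer than q = (1 - P) v. For small c > 0, write rho - c v v^* = A - B with
   B = c (1 + 1/t) q q^* and A = rho - c (1 + t) p p^* + (c / t) r r^*, where
   r = q - t p. As p lies in the range of rho, A is positive semidefinite for
   small c, and then |rho - c v v^*|_tr is at most
   tr A + tr B = 1 + c (|q|^2 - |p|^2 + 2 |q|^2 / t), less than 1 for t large. *)
Require Import Defs.
From mathcomp Require Import all_boot all_order all_algebra.
From mathcomp Require Import complex.
From mathcomp Require Import boolp classical_sets reals.
From mathcomp Require Import ring.

Import Order.TTheory GRing.Theory Num.Theory.
Local Open Scope ring_scope.
Local Open Scope complex_scope.
Local Open Scope sesquilinear_scope.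

Local Set Implicit Arguments.
Local Unset Strict Implicit.

(** * Nonnegative quadratic forms and their closure properties *)

Section NonnegForms.
Context {C : numClosedFieldType}.
Implicit Types n m : nat.

(** This is the form condition of [psdmx] alone, so that congruences and sums carry no Hermitian
    side condition. *)
Definition nnegmx n (A : 'M[C]_n) : Prop :=
  forall v : 'cV[C]_n, 0 <= (v ^t* *m A *m v) 0 0.

Lemma adjmxM m n p (A : 'M[C]_(m, n)) (B : 'M[C]_(n, p)) :
  (A *m B) ^t* = B ^t* *m A ^t*.
Proof. by rewrite trmx_mul map_mxM. Qed.

Lemma adjmxB m n (A B : 'M[C]_(m, n)) : (A - B) ^t* = A ^t* - B ^t*.
Proof. by rewrite linearB /= map_mxB. Qed.

Lemma adjmxZ m n (a : C) (A : 'M[C]_(m, n)) :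
  (a *: A) ^t* = Num.conj a *: A ^t*.
Proof. by rewrite linearZ /= map_mxZ. Qed.

Lemma adjmx1 n : 1%:M ^t* = 1%:M :> 'M[C]_n.
Proof. by rewrite trmx1 map_mx1. Qed.

Lemma hermsymmxP n (A : 'M[C]_n) : A \is hermsymmx <-> A ^t* = A.
Proof.
rewrite is_hermitianmxE expr0 scale1r.
by split=> [/eqP <-//|->].
Qed.

Lemma nnegmxD n (A B : 'M[C]_n) : nnegmx A -> nnegmx B -> nnegmx (A + B).
Proof. by move=> hA hB v; rewrite mulmxDr mulmxDl mxE addr_ge0. Qed.

Lemma nnegmxZ n (a : C) (A : 'M[C]_n) : 0 <= a -> nnegmx A -> nnegmx (a *: A).
Proof. by move=> ha hA v; rewrite -scalemxAr -scalemxAl mxE mulr_ge0. Qed.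

Lemma nnegmx_congr m n (B : 'M[C]_(n, m)) (A : 'M[C]_n) :
  nnegmx A -> nnegmx (B ^t* *m A *m B).
Proof. by move=> hA v; have := hA (B *m v); rewrite adjmxM !mulmxA. Qed.

Lemma nnegmx1 n : nnegmx (1%:M : 'M_n).
Proof.
move=> v; rewrite mulmx1 mxE sumr_ge0// => i _.
by rewrite !mxE mulrC mul_conjC_ge0.
Qed.

Lemma nnegmx_gram m n (B : 'M[C]_(n, m)) : nnegmx (B ^t* *m B).
Proof. by rewrite -[B ^t*]mulmx1; exact/nnegmx_congr/nnegmx1. Qed.

Lemma nnegmx_outer n (v : 'cV[C]_n) : nnegmx (v *m v ^t*).
Proof. by have := nnegmx_gram (v ^t*); rewrite trmxCK. Qed.

Lemma nnegmx_diag_ge0 n (A : 'M[C]_n) i : nnegmx A -> 0 <= A i i.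
Proof.
move=> /(_ (delta_mx i 0)).
by rewrite trmx_delta map_delta_mx -rowE -colE !mxE.
Qed.

Lemma nnegmx_diag_mx n (d : 'rV[C]_n) :
  (forall i, 0 <= d 0 i) -> nnegmx (diag_mx d).
Proof.
move=> d0 v; rewrite -mulmxA mul_diag_mx mxE sumr_ge0// => i _.
by rewrite !mxE mulrCA mulr_ge0// mulrC mul_conjC_ge0.
Qed.

Lemma nnegmx_unitary m n (U : 'M[C]_(m, n)) (A : 'M[C]_n) :
  nnegmx A -> nnegmx (U *m A *m U ^t*).
Proof. by move=> /(nnegmx_congr (U ^t*)); rewrite trmxCK. Qed.

(** * Unitary conjugation, diagonalization and spectra *)

Lemma unitarymx_adjMmx n (U : 'M[C]_n) : U \is unitarymx -> U ^t* *m U = 1%:M.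
Proof. by move=> /unitarymxP; exact: mulmx1C. Qed.

Lemma mxtrace_unitary n (U A : 'M[C]_n) : U \is unitarymx ->
  \tr (U *m A *m U ^t*) = \tr A.
Proof.
by move=> hU; rewrite mxtrace_mulC mulmxA unitarymx_adjMmx// mul1mx.
Qed.

Lemma mxtrace_outer n (v : 'cV[C]_n) : \tr (v *m v ^t*) = (v ^t* *m v) 0 0.
Proof. by rewrite mxtrace_mulC trace_mx11. Qed.

Lemma normalmx_spectral n (A : 'M[C]_n) : A \is normalmx ->
  A = (spectralmx A) ^t* *m diag_mx (spectral_diag A) *m spectralmx A.
Proof.
by move=> /orthomx_spectralP; rewrite invmx_unitary ?spectral_unitarymx.
Qed.

Lemma normalmx_diagonalized n (A : 'M[C]_n) : A \is normalmx ->
  spectralmx A *m A *m (spectralmx A) ^t* = diag_mx (spectral_diag A).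
Proof.
move=> /normalmx_spectral; have := spectral_unitarymx A.
move: (spectralmx A) (spectral_diag A) => U d hU ->.
by rewrite !mulmxA (unitarymxP hU) mul1mx mulmxtVK.
Qed.

Lemma char_poly_unitary n (U A : 'M[C]_n) : U \is unitarymx ->
  char_poly (U ^t* *m A *m U) = char_poly A.
Proof.
move=> hU; have hU' := unitarymx_adjMmx hU.
rewrite /char_poly /char_poly_mx !map_mxM.
set V := map_mx polyC U; set V' := map_mx polyC (U ^t*).
have hV : V' *m V = 1%:M by rewrite -map_mxM hU' map_mx1.
have -> : 'X%:M - V' *m map_mx polyC A *m V =
          V' *m ('X%:M - map_mx polyC A) *m V.
  by rewrite mulmxBr mulmxBl scalar_mxC -[_ *m V' *m V]mulmxA hV mulmx1.
by rewrite !det_mulmx mulrAC -det_mulmx hV det1 mul1r.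
Qed.

(** Two diagonalizations of one matrix share the characteristic polynomial, so by unique
    factorization [d] and [e] are permutations of each other. This lets any convenient
    diagonalization replace the one chosen by [spectral_diag]. *)
Lemma sum_spectrum (V : nmodType) n (U W : 'M[C]_n) (d e : 'rV[C]_n)
    (F : C -> V) :
  U \is unitarymx -> W \is unitarymx ->
  U ^t* *m diag_mx d *m U = W ^t* *m diag_mx e *m W ->
  \sum_i F (d 0 i) = \sum_i F (e 0 i).
Proof.
move=> hU hW /(congr1 char_poly); rewrite !char_poly_unitary//.
rewrite !char_poly_trig ?diag_mx_is_trig//.
under eq_bigr do rewrite mxE eqxx mulr1n.
under [in RHS]eq_bigr do rewrite mxE eqxx mulr1n.
rewrite -(big_map (d 0) predT (fun x => 'X - x%:P)).
rewrite -(big_map (e 0) predT (fun x => 'X - x%:P)).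
move=> /prod_XsubC_eq de.
by rewrite -(big_map (d 0) predT F) -(big_map (e 0) predT F); exact: perm_big.
Qed.

(** * Rank-one perturbations of a nonnegative matrix *)

Lemma nnegmx_sub_range n (A : 'M[C]_n) (w : 'cV[C]_n) (s : C) :
  A ^t* = A -> nnegmx A -> 0 <= s -> s * (w ^t* *m A *m w) 0 0 <= 1 ->
  nnegmx (A - s *: ((A *m w) *m (A *m w) ^t*)).
Proof.
move=> AH A0 s0; set d := (_ *m w) 0 0 => sd.
set p := A *m w; pose B := 1%:M - s *: (w *m p ^t*).
have sR : Num.conj s = s by rewrite conj_Creal ?ger0_real.
(* Congruence by [B] turns [A] into A - 2s pp^* + s^2 d pp^*; what is left over is a multiple of
   pp^* that is nonnegative because s d <= 1. *)
have -> : A - s *: (p *m p ^t*) =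
    B ^t* *m A *m B + (s * (1 - s * d)) *: (p *m p ^t*).
  rewrite /B adjmxB adjmx1 adjmxZ (adjmxM w) trmxCK sR.
  rewrite !(mulmxBl, mulmxBr, mul1mx, mulmx1, =^~ scalemxAl, =^~ scalemxAr).
  have wA : w ^t* *m A = p ^t* by rewrite adjmxM AH.
  have wAw : p ^t* *m w = d%:M by rewrite -wA [LHS]mx11_scalar.
  rewrite -!(mulmxA p) wA !mulmxA -/p -(mulmxA p) wAw.
  rewrite mul_mx_scalar -scalemxAl; move: (p *m p ^t*) => Q.
  by apply/matrixP=> i j; rewrite !mxE; ring.
apply: nnegmxD; first exact: nnegmx_congr.
by apply: nnegmxZ; [rewrite mulr_ge0// subr_ge0|exact: nnegmx_outer].
Qed.

(** The cross terms p q^* and q p^* are absorbed by the square of q - t p, as in Young's inequality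
    with weight t, but with the remainder kept exactly. *)
Lemma sub_outerD n (A : 'M[C]_n) (p q : 'cV[C]_n) (c t : C) : 0 < t ->
  A - c *: ((p + q) *m (p + q) ^t*) =
  A - (c * (1 + t)) *: (p *m p ^t*)
    + (c / t) *: ((q - t *: p) *m (q - t *: p) ^t*)
  - (c * (1 + t^-1)) *: (q *m q ^t*).
Proof.
move=> t0; have tR : Num.conj t = t by rewrite conj_Creal ?gtr0_real.
rewrite adjmxB adjmxZ tR.
have -> : (p + q) ^t* = p ^t* + q ^t* by rewrite raddfD /= map_mxD.
rewrite !(mulmxBl, mulmxBr, mulmxDl, mulmxDr, =^~ scalemxAl, =^~ scalemxAr).
move: (p *m p ^t*) (p *m q ^t*) (q *m p ^t*) (q *m q ^t*) => pp pq qp qq.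
apply/matrixP=> i j; rewrite !mxE.
move: (A i j) (pp i j) (pq i j) (qp i j) (qq i j) => a b1 b2 b3 b4.
by field; rewrite gt_eqF.
Qed.

Lemma sub_outer_decomposition n (rho P Z : 'M[C]_n) (v : 'cV[C]_n) :
  rho ^t* = rho -> nnegmx rho -> \tr rho = 1 ->
  P *m P = P -> P ^t* = P -> P = rho *m Z ->
  ~ (0 <= (v ^t* *m (1%:M - 2 *: P) *m v) 0 0) ->
  exists2 c : C, 0 <= c & exists A B : 'M[C]_n,
    [/\ nnegmx A, nnegmx B, rho - c *: (v *m v ^t*) = A - B &
        \tr A + \tr B < 1].
Proof.
move=> rhoH rho0 tr1 PP PH PZ.
pose p := P *m v; pose q := v - p; pose w := Z *m v.
have pw : p = rho *m w by rewrite /p PZ mulmxA.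
pose al := (p ^t* *m p) 0 0; pose be := (q ^t* *m q) 0 0.
have alE : (v ^t* *m P *m v) 0 0 = al.
  by rewrite /al /p adjmxM PH -{1}PP !mulmxA.
have beE : be = (v ^t* *m v) 0 0 - al.
  rewrite /be -alE /q /p adjmxB adjmxM PH mulmxBr !mulmxBl !mulmxA.
  by rewrite -(mulmxA _ P P) PP !mxE; ring.
have form1 (u : 'cV[C]_n) : 0 <= (u ^t* *m u) 0 0.
  by have := nnegmx1 u; rewrite mulmx1.
have al0 : 0 <= al by exact: form1.
have be0 : 0 <= be by exact: form1.
(* Since [P] is an orthogonal projection, |v|^2 = al + be, so the failing form says |q|^2 <
   |p|^2. *)
have -> : (v ^t* *m (1%:M - 2 *: P) *m v) 0 0 = be - al.
  rewrite mulmxBr mulmxBl mulmx1 -scalemxAr -scalemxAl.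
  rewrite beE -alE; move: (v ^t* *m v) (v ^t* *m P *m v) => x y.
  by rewrite !mxE; ring.
rewrite subr_ge0 => /negP.
rewrite -real_ltNge; [|exact: ger0_real..] => lt_be_al.
have al_gt0 : 0 < al by exact: le_lt_trans lt_be_al.
pose d := (w ^t* *m rho *m w) 0 0; have d0 : 0 <= d by exact: rho0.
(* [t] makes the error 2 be / t equal to be (al - be) / al, a fraction be / al < 1 of the gain al -
   be. [c] makes c (1 + t) d = d / (d + 1) <= 1, the condition for subtracting the multiple of p p^*
   from [rho]. *)
pose t := 2 * al / (al - be); pose c := ((1 + t) * (d + 1))^-1.
have t0 : 0 < t by rewrite divr_gt0 ?(mulr_gt0 (ltr0n _ 2))// subr_gt0.
have d1 : 0 < d + 1 by rewrite ltr_wpDl.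
have t1 : 0 < 1 + t by rewrite addr_gt0.
have c0 : 0 < c by rewrite invr_gt0 mulr_gt0.
pose r := q - t *: p.
pose A := rho - (c * (1 + t)) *: (p *m p ^t*) + (c / t) *: (r *m r ^t*).
pose B := (c * (1 + t^-1)) *: (q *m q ^t*).
have AB : rho - c *: (v *m v ^t*) = A - B.
  have vE : v = p + q by rewrite addrC subrK.
  by rewrite [in LHS]vE (sub_outerD _ _ _ _ t0).
exists c; first exact: ltW.
exists A, B.
have A0 : nnegmx A.
  apply: nnegmxD; last first.
    by apply: nnegmxZ; [rewrite ltW// divr_gt0|exact: nnegmx_outer].
  rewrite pw; apply: nnegmx_sub_range => //; first by rewrite ltW// mulr_gt0.
  have -> : c * (1 + t) = (d + 1)^-1 by rewrite /c; field; rewrite !gt_eqF.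
  by rewrite mulrC ler_pdivrMr// mul1r lerDl.
have B0 : nnegmx B.
  apply: nnegmxZ; last exact: nnegmx_outer.
  by rewrite ltW// mulr_gt0// addr_gt0// invr_gt0.
split=> //.
(* This avoids expanding the trace of [A]: the trace of A - B is 1 - c |v|^2, and only the trace of
   [B] is computed directly. *)
have -> : \tr A + \tr B = \tr (A - B) + 2 * \tr B by rewrite raddfB /=; ring.
rewrite -AB raddfB /= !linearZ /= !mxtrace_outer tr1.
have -> : (v ^t* *m v) 0 0 = be + al by rewrite beE subrK.
rewrite -/be.
have -> : 1 - c * (be + al) + 2 * (c * (1 + t^-1) * be) =
    1 - c * (al - be) * (al - be) / al.
  by rewrite /t; field; rewrite !gt_eqF// subr_gt0.
by rewrite gtrBl divr_gt0// mulr_gt0 ?subr_gt0// mulr_gt0 ?subr_gt0.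
Qed.

(** * Eigenvalue estimates behind the two norms *)

Lemma normalmx_gram n (A : 'M[C]_n) : A ^t* *m A \is normalmx.
Proof. by apply/normalmxP; rewrite adjmxM trmxCK. Qed.

Lemma gram_diagonalized n (U : 'M[C]_n) (h : 'rV[C]_n) : U \is unitarymx ->
  (U ^t* *m diag_mx h *m U) ^t* *m (U ^t* *m diag_mx h *m U) =
  U ^t* *m diag_mx (\row_i (`|h 0 i| ^+ 2)) *m U.
Proof.
move=> hU; rewrite !adjmxM trmxCK !mulmxA -(mulmxA _ U) (unitarymxP hU) mulmx1.
rewrite -(mulmxA (U ^t*) _ (diag_mx h)); congr (_ *m _ *m _).
rewrite tr_diag_mx map_diag_mx mulmx_diag; congr diag_mx.
by apply/rowP => j; rewrite !mxE normCK mulrC.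
Qed.

(** In the eigenbasis of A - B each eigenvalue is a difference of diagonal entries of the conjugated
    [A] and [B]. These are nonnegative, and they sum to the traces. *)
Lemma sum_norm_diag_le n (U A B : 'M[C]_n) (h : 'rV[C]_n) :
  U \is unitarymx -> nnegmx A -> nnegmx B ->
  U *m (A - B) *m U ^t* = diag_mx h -> \sum_i `|h 0 i| <= \tr A + \tr B.
Proof.
move=> hU hA hB hD.
rewrite -(mxtrace_unitary A hU) -(mxtrace_unitary B hU) -big_split /=.
apply: ler_sum => i _.
have -> : h 0 i = (U *m A *m U ^t*) i i - (U *m B *m U ^t*) i i.
  have : (U *m (A - B) *m U ^t*) i i = h 0 i by rewrite hD mxE eqxx mulr1n.
  by rewrite mulmxBr mulmxBl !mxE.
have hA' := nnegmx_diag_ge0 i (nnegmx_unitary U hA).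
have hB' := nnegmx_diag_ge0 i (nnegmx_unitary U hB).
by apply: le_trans (ler_normB _ _) _; rewrite !ger0_norm.
Qed.

(** In the eigenbasis of [H] the trace is the sum of the eigenvalues weighted by the diagonal
    entries of the conjugated [W], which lie in [-1, 1]. *)
Lemma mxtrace_mul_le_sum_norm n (U W H : 'M[C]_n) (h : 'rV[C]_n) :
  U \is unitarymx -> nnegmx (1%:M - W) -> nnegmx (1%:M + W) ->
  (forall i, h 0 i \is Num.real) -> U *m H *m U ^t* = diag_mx h ->
  \tr (W *m H) <= \sum_i `|h 0 i|.
Proof.
move=> hU hm hp hr hD; rewrite -(mxtrace_unitary _ hU).
have -> : U *m (W *m H) *m U ^t* = U *m W *m U ^t* *m diag_mx h.
  by rewrite -hD !mulmxA mulmxKtV.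
rewrite mul_mx_diag; apply: ler_sum => i _; rewrite mxE.
have := nnegmx_diag_ge0 i (nnegmx_unitary U hm).
have := nnegmx_diag_ge0 i (nnegmx_unitary U hp).
rewrite mulmxDr mulmxBr mulmx1 mulmxDl mulmxBl (unitarymxP hU).
move: (U *m W *m U ^t*) => Z; rewrite !mxE eqxx mulr1n => lp lm.
(* Nonnegative elements of [C] are real, so [Z i i] is real because 1 + Z i i is nonnegative. *)
have Zr : Z i i \is Num.real.
  by rewrite -(addKr 1 (Z i i)) realD ?realN ?real1 ?ger0_real.
have Z1 : `|Z i i| <= 1.
  by rewrite real_ler_norml// lerNl -[- _ <= 1]subr_ge0 opprK lp -subr_ge0.
apply: le_trans (real_ler_norm (realM Zr (hr i))) _.
by rewrite normrM ler_piMl.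
Qed.

Lemma spectral_diag_leP n (A : 'M[C]_n) (c : C) : A \is normalmx ->
  (forall i, spectral_diag A 0 i <= c) <-> nnegmx (c%:M - A).
Proof.
move=> hN; set U := spectralmx A; set d := spectral_diag A.
have hU : U \is unitarymx by exact: spectral_unitarymx.
have hE : U *m (c%:M - A) *m U ^t* = diag_mx (\row_i (c - d 0 i)).
  rewrite mulmxBr mulmxBl normalmx_diagonalized// scalar_mxC -mulmxA.
  rewrite (unitarymxP hU) mulmx1; apply/matrixP=> i j; rewrite !mxE.
  by case: eqP => [->|_]; rewrite ?mulr1n ?mulr0n ?subrr.
split=> [dc|hn i].
- have -> : c%:M - A = U ^t* *m diag_mx (\row_i (c - d 0 i)) *m U.
    by rewrite -hE !mulmxA unitarymx_adjMmx// mul1mx mulmxKtV.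
  by apply/nnegmx_congr/nnegmx_diag_mx => i; rewrite mxE subr_ge0.
- rewrite -subr_ge0; have := nnegmx_diag_ge0 i (nnegmx_unitary U hn).
  by rewrite hE !mxE eqxx mulr1n.
Qed.

(** This is q^2 <= 1/4 iff q <= 1/2 for q >= 0, lifted to matrices by explicit identities whose
    summands are all congruences or Gram matrices. It makes the norm condition on a block linear in
    the block. *)
Lemma nnegmx_quarter_sub_sqr n (Q : 'M[C]_n) : Q ^t* = Q -> nnegmx Q ->
  nnegmx ((1 / 4)%:M - Q *m Q) <-> nnegmx (1%:M - 2 *: Q).
Proof.
move=> hQ Q0; have h2 : 0 <= 1 / 2 :> C by rewrite divr_ge0.
have hadj : (2 *: Q) ^t* = 2 *: Q by rewrite adjmxZ hQ conjC_nat.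
split=> hn.
- have -> : 1%:M - 2 *: Q = 2 *: ((1 / 4)%:M - Q *m Q) +
      (1 / 2) *: ((1%:M - 2 *: Q) ^t* *m (1%:M - 2 *: Q)).
    rewrite adjmxB adjmx1 hadj mulmxBr !mulmxBl !mulmx1 !mul1mx.
    rewrite -!scalemxAl -!scalemxAr; move: (Q *m Q) => QQ.
    by apply/matrixP=> i j; rewrite !mxE; case: eqP => _;
      rewrite ?mulr1n ?mulr0n; field.
  apply: nnegmxD; first exact: nnegmxZ.
  by apply: nnegmxZ => //; exact: nnegmx_gram.
(* The product Q (1 - 2Q) is written as (1 - 2Q) Q (1 - 2Q) + 2 Q (1 - 2Q) Q, a sum of congruences
   of [Q] and of 1 - 2Q. *)
- have -> : (1 / 4)%:M - Q *m Q = (1 / 2) *: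
      ((1 / 2) *: (1%:M - 2 *: Q)
       + ((1%:M - 2 *: Q) ^t* *m Q *m (1%:M - 2 *: Q)
          + 2 *: (Q ^t* *m (1%:M - 2 *: Q) *m Q))).
    rewrite adjmxB adjmx1 hadj hQ.
    rewrite !(mulmxBl, mulmxBr, mul1mx, mulmx1, =^~ scalemxAl, =^~ scalemxAr).
    move: (Q *m Q *m Q) (Q *m Q) => QQQ QQ.
    by apply/matrixP=> i j; rewrite !mxE; case: eqP => _;
      rewrite ?mulr1n ?mulr0n; field.
  apply: nnegmxZ => //; apply: nnegmxD; first exact: nnegmxZ.
  apply: nnegmxD; first exact: nnegmx_congr.
  by apply: nnegmxZ => //; exact: nnegmx_congr.
Qed.

End NonnegForms.

(** * Trace norm and operator norm in terms of nonnegative forms *)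

Section Norms.
Context {R : realType}.
Local Notation C := R[i].
Implicit Types n : nat.

Lemma singvalE n (A : 'M[C]_n) i :
  (singval A i)%:C = sqrtC (spectral_diag (A ^t* *m A) 0 i).
Proof.
have d0 : 0 <= spectral_diag (A ^t* *m A) 0 i.
  have /(nnegmx_diag_ge0 i) :=
    nnegmx_unitary (spectralmx (A ^t* *m A)) (nnegmx_gram A).
  by rewrite normalmx_diagonalized ?normalmx_gram// mxE eqxx mulr1n.
rewrite /singval; move: d0; set d := spectral_diag _ _ _ => d0.
apply/eqP; rewrite -(@eqrXn2 _ 2)// ?sqrtC_ge0 ?ler0c ?sqrtr_ge0//.
have hd : 0 <= complex.Re d by rewrite -ler0c RRe_real// ger0_real.
by rewrite sqrtCK -rmorphXn /= sqr_sqrtr// RRe_real// ger0_real.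
Qed.

(** The same [U] diagonalizes the Gram matrix, with eigenvalues |h_i|^2, and [sum_spectrum] allows
    the singular values to be read off from it. *)
Lemma trnorm_diagonalized n (U : 'M[C]_n) (h : 'rV[C]_n) : U \is unitarymx ->
  (trnorm (U ^t* *m diag_mx h *m U))%:C = \sum_i `|h 0 i|.
Proof.
move=> hU; rewrite /trnorm rmorph_sum /=.
under eq_bigr do rewrite singvalE.
move: (U ^t* *m diag_mx h *m U) (gram_diagonalized h hU) => A hA.
have := normalmx_spectral (normalmx_gram A); rewrite [LHS]hA => /esym E.
rewrite (sum_spectrum sqrtC (spectral_unitarymx _) hU E).
by apply: eq_bigr => i _; rewrite mxE sqrCK.
Qed.

Lemma trnorm_hermsym n (H : 'M[C]_n) : H \is hermsymmx ->
  exists U : 'M[C]_n, exists2 h : 'rV[C]_n, U \is unitarymx &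
  [/\ forall i, h 0 i \is Num.real, U *m H *m U ^t* = diag_mx h &
      (trnorm H)%:C = \sum_i `|h 0 i|].
Proof.
move=> hH; have hN := hermitian_normalmx hH.
have hU := spectral_unitarymx H.
exists (spectralmx H), (spectral_diag H) => //.
split; last 2 first.
- exact: normalmx_diagonalized.
- rewrite -(trnorm_diagonalized _ hU); congr (trnorm _)%:C.
  exact: normalmx_spectral.
by move=> i; have /mxOverP := hermitian_spectral_diag_real hH; apply.
Qed.

Lemma trnorm_sub_le n (A B : 'M[C]_n) :
  nnegmx A -> nnegmx B -> A - B \is hermsymmx ->
  (trnorm (A - B))%:C <= \tr A + \tr B.
Proof.
move=> hA hB /trnorm_hermsym[U [h hU [_ hD ->]]].
exact: (sum_norm_diag_le hU hA hB hD).
Qed.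

Lemma mxtrace_mul_le_trnorm n (W H : 'M[C]_n) :
  nnegmx (1%:M - W) -> nnegmx (1%:M + W) -> H \is hermsymmx ->
  \tr (W *m H) <= (trnorm H)%:C.
Proof.
move=> hm hp /trnorm_hermsym[U [h hU [hr hD ->]]].
exact: (mxtrace_mul_le_sum_norm hU hm hp hr hD).
Qed.

Lemma opnorm_leP n (A : 'M[C]_n) (c : R) : 0 <= c ->
  opnorm A <= c <-> nnegmx ((c%:C ^+ 2)%:M - A ^t* *m A).
Proof.
move=> c0; have hd i : (singval A i <= c) =
    (spectral_diag (A ^t* *m A) 0 i <= c%:C ^+ 2).
  rewrite -lecR singvalE -[X in _ = (X <= _)]sqrtCK.
  have : 0 <= sqrtC (spectral_diag (A ^t* *m A) 0 i).
    by rewrite -singvalE ler0c sqrtr_ge0.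
  have : 0 <= c%:C by rewrite ler0c.
  move: (sqrtC _) (c%:C) => x y y0 x0.
  by rewrite ler_pXn2r.
apply: iff_trans (spectral_diag_leP _ (normalmx_gram A)).
split=> [hop i|hop].
- by rewrite -hd; apply: le_trans hop; exact: le_bigmax.
(* The maximum in [opnorm] starts from 0, so [0 <= c] enters here. *)
- by apply: bigmax_le => // i _; rewrite hd.
Qed.

Lemma opnorm_le_halfP n (Q : 'M[C]_n) : Q ^t* = Q -> nnegmx Q ->
  opnorm Q <= 1 / 2 <-> nnegmx (1%:M - 2 *: Q).
Proof.
move=> hQ Q0; have half0 : 0 <= 1 / 2 :> R by rewrite divr_ge0.
apply: iff_trans (opnorm_leP Q half0) _.
apply: iff_trans (nnegmx_quarter_sub_sqr hQ Q0); rewrite hQ.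
suff -> : (1 / 2 : R)%:C ^+ 2 = 1 / 4 :> C by [].
have -> : (1 / 2 : R)%:C = 1 / 2 by rewrite fmorph_div /= rmorph1 rmorph_nat.
by rewrite expr_div_n expr1n -natrX.
Qed.

End Norms.

(** * Index sets and coordinate embeddings *)

Lemma exists_superset_card (T : finType) (A : {set T}) k :
  (#|A| <= k)%N -> (k <= #|T|)%N -> exists2 S : {set T}, A \subset S & #|S| = k.
Proof.
elim: k => [|k IH]; first by rewrite leqn0 => /eqP; exists A.
rewrite leq_eqVlt => /predU1P[Ak _|/IH {}IH kT]; first by exists A.
have [S AS Sk] := IH (ltnW kT).
have [x xS] : exists x, x \notin S.
  apply/existsP; rewrite -negb_forall; apply/negP => /forallP hS.
  have ST : #|S| = #|T| by apply: eq_card => x; rewrite hS.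
  by move: kT; rewrite -ST Sk ltnn.
exists (x |: S); first by rewrite (fintype.subset_trans AS)// finset.subsetUr.
by rewrite cardsU1 xS Sk.
Qed.

(** A small support is padded to exactly k indices and enumerated in order, so every vector with at
    most k nonzero entries lives on one principal block. *)
Lemma exists_increasing_cover n k (A : {set 'I_n}) :
  (#|A| <= k)%N -> (k <= n)%N ->
  exists2 f : 'I_k -> 'I_n, {homo f : a b / (a < b)%N} &
    forall i, i \in A -> exists a, f a = i.
Proof.
move=> Ak kn; have [|S AS Sk] := exists_superset_card Ak; first by rewrite card_ord.
subst k; exists enum_val; last first.
  move=> i /(fintype.subsetP AS) iS.
  by exists (enum_rank_in iS i); rewrite enum_rankK_in.
move=> a b ab.
(* [enum S] filters the enumeration of ['I_n], whose values form an increasing [iota]. *)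
have es : sorted (fun i j : 'I_n => (i < j)%N) (enum S).
  rewrite /enum_mem; apply: sorted_filter.
    by move=> x y z; exact: ltn_trans.
  rewrite -enumT -[sorted _ _](@sorted_map _ _ val ltn (enum 'I_n)).
  by rewrite val_enum_ord iota_ltn_sorted.
have ltt : transitive (fun i j : 'I_n => (i < j)%N).
  by move=> x y z; exact: ltn_trans.
have x0 : 'I_n := enum_val a.
rewrite !(enum_val_nth x0).
by apply: (sorted_ltn_nth ltt _ es) ab; rewrite inE -cardE ltn_ord.
Qed.

Lemma increasing_inj n k (f : 'I_k -> 'I_n) :
  {homo f : a b / (a < b)%N} -> injective f.
Proof.
move=> hf a b fab; apply/val_inj.
by case: (ltngtP a b) => // /hf; rewrite fab ltnn.
Qed.

Section CoordinateEmbedding.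
Context {C : numClosedFieldType} {n k : nat}.
Variable f : 'I_k -> 'I_n.

(** Column [a] is the standard basis vector at [f a]: [E] places a vector of length k on the
    coordinates chosen by [f]. *)
Let E : 'M[C]_(n, k) := colsub f 1%:M.

Lemma adj_colsub1 : E ^t* = rowsub f 1%:M.
Proof. by rewrite trmx_mxsub map_mxsub adjmx1. Qed.

Lemma mxsub_congr (A : 'M[C]_n) : mxsub f f A = E ^t* *m A *m E.
Proof.
rewrite adj_colsub1 -rowsubE mulmx_colsub mulmx1.
by apply/matrixP => i j; rewrite !mxE.
Qed.

Lemma colsub1_isometry : injective f -> E ^t* *m E = 1%:M.
Proof.
move=> hf; rewrite adj_colsub1 -mxsub_mul mulmx1.
by apply/matrixP => i j; rewrite !mxE (inj_eq hf).
Qed.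

Lemma colsub1_mul_eq0 (x : 'cV[C]_k) i : (forall a, f a != i) -> (E *m x) i 0 = 0.
Proof.
move=> hi; rewrite mxE big1// => a _.
by rewrite !mxE eq_sym (negPf (hi a)) mul0r.
Qed.

(** E E^* is the projection onto the coordinates in the image of [f], and it fixes [v]. *)
Lemma colsub1_mul_restrict (v : 'cV[C]_n) : injective f ->
  (forall i, v i 0 != 0 -> exists a, f a = i) -> E *m rowsub f v = v.
Proof.
move=> hf hv; apply/colP => i; have [vi0|/hv [a <-]] := eqVneq (v i 0) 0.
  rewrite vi0 mxE big1// => a _; rewrite !mxE.
  by case: eqVneq => [<-|]; rewrite ?vi0 ?mulr0 ?mul0r.
rewrite mxE (bigD1 a)//= !mxE eqxx mul1r big1 ?addr0// => b ba.
by rewrite !mxE (inj_eq hf) eq_sym (negPf ba) mul0r.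
Qed.

End CoordinateEmbedding.

Lemma nnz_colsub1 (R : realType) n k (f : 'I_k -> 'I_n) (x : 'cV[R[i]]_k) :
  (nnz (colsub f 1%:M *m x) <= k)%N.
Proof.
apply: leq_trans (_ : #|codom f| <= k)%N; last first.
  by rewrite (leq_trans (card_size _))// size_codom card_ord.
apply/subset_leq_card/fintype.subsetP => i; rewrite inE; apply: contraR => hi.
apply/eqP/colsub1_mul_eq0 => a; apply: contraNneq hi => <-.
exact: codom_f.
Qed.

(** * The cone of k-coherent matrices and the distance to it *)

Section KCoherence.
Context {R : realType}.
Local Notation C := R[i].
Implicit Types n k : nat.

(** Each inclusion of column spaces gives a factorization. [P *m A = A] fixes the trace against the
    state, and P = A Z puts P v in the range of [A] with an explicit preimage. *)
Lemma orthoproj_range_factor n (P A : 'M[C]_n) : orthoproj_range P A ->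
  P *m A = A /\ exists Z, P = A *m Z.
Proof.
case=> PP _ /andP[/submxP[Y hY] /submxP[Z hZ]]; split; last first.
  by exists Y^T; rewrite -[P]trmxK hY trmx_mul trmxK.
have -> : A = P *m Z^T by rewrite -[A]trmxK hZ trmx_mul trmxK.
by rewrite mulmxA PP.
Qed.

Lemma orthoproj_nneg n (P A : 'M[C]_n) : orthoproj_range P A -> nnegmx P.
Proof. by case=> PP hP _; rewrite -PP -{1}hP; exact: nnegmx_gram. Qed.

(** The upper bound splits [rho] as rho - 0; the lower bound tests against the identity. *)
Lemma trnorm_mixed_state n (rho : 'M[C]_n) : mixed_state rho -> trnorm rho = 1.
Proof.
case=> -[rhoH rho0] tr1; apply/le_anti/andP; split; rewrite -lecR.
  have z0 : nnegmx (0 : 'M[C]_n) by move=> v; rewrite mulmx0 mul0mx mxE.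
  have rhoH' : rho - 0 \is hermsymmx by rewrite subr0.
  have := trnorm_sub_le rho0 z0 rhoH'.
  by rewrite [rho - 0]subr0 mxtrace0 addr0 tr1.
have hm : nnegmx (1%:M - 1%:M : 'M[C]_n).
  by move=> v; rewrite subrr mulmx0 mul0mx mxE.
have hp : nnegmx (1%:M + 1%:M : 'M[C]_n) by apply: nnegmxD; exact: nnegmx1.
by have := mxtrace_mul_le_trnorm hm hp rhoH; rewrite mul1mx tr1.
Qed.

Lemma coh_dist_eq1P n k (rho : 'M[C]_n) : mixed_state rho ->
  coh_dist k rho = 1 <-> forall X, coh_cone k X -> 1 <= trnorm (rho - X).
Proof.
move=> hrho; rewrite /coh_dist /minimum.
set S := (X in [set d | X d /\ _]%classic).
have S1 : S 1.
  exists 0; last by rewrite subr0 trnorm_mixed_state.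
  (* The zero matrix is the empty sum. *)
  by exists 0%N, (fun=> 0); split=> [[]//|]; rewrite big_ord0.
split.
  (* The placeholder 0 of [minimum] differs from 1, so the value 1 can only be a genuine minimum. *)
  case: xgetP => [d -> [_ lb] d1 X hX|_ /eqP]; last by rewrite eq_sym oner_eq0.
  by rewrite -d1; apply: lb; exists X.
move=> hX; apply: xget_unique.
  by split=> // _ [X Xk <-]; exact: hX.
move=> d [Sd lb]; apply/le_anti; rewrite lb//=.
by case: Sd => X Xk <-; exact: hX.
Qed.

Lemma coh_cone_hermsym n k (X : 'M[C]_n) : coh_cone k X -> X ^t* = X.
Proof.
case=> m [v [_ ->]]; rewrite linear_sum /= raddf_sum /=.
by apply: eq_bigr => j _; rewrite adjmxM trmxCK.
Qed.

Lemma trnorm_sub_coh_ge1 n k (rho P X : 'M[C]_n) :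
  mixed_state rho -> orthoproj_range P rho ->
  (forall v : 'cV[C]_n, (nnz v <= k)%N ->
     0 <= (v ^t* *m (1%:M - 2 *: P) *m v) 0 0) ->
  coh_cone k X -> 1 <= trnorm (rho - X).
Proof.
move=> [[rhoH _] tr1] hP hv hX; rewrite -lecR.
have P0 := orthoproj_nneg hP; have [Prho _] := orthoproj_range_factor hP.
have PP : P *m P = P by case: hP.
have PH : P ^t* = P by case: hP.
pose W := 2 *: P - 1%:M.
apply: le_trans (@mxtrace_mul_le_trnorm _ _ W _ _ _ _); first last.
- move/hermsymmxP: rhoH => rhoH.
  by apply/hermsymmxP; rewrite adjmxB (coh_cone_hermsym hX) rhoH.
- by rewrite /W addrC subrK; exact: nnegmxZ (ler0n _ 2) P0.
(* Here 1 - W = 2 (1 - P), and the projection 1 - P is its own Gram matrix. *)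
- have -> : 1%:M - W = 2 *: ((1%:M - P) ^t* *m (1%:M - P)).
    rewrite adjmxB adjmx1 PH mulmxBr mulmx1 mulmxBl mul1mx PP subrr subr0.
    by apply/matrixP=> i j; rewrite !mxE; ring.
  by apply: nnegmxZ (nnegmx_gram _); exact: ler0n.
have -> : \tr (W *m (rho - X)) = 1 + \tr ((1%:M - 2 *: P) *m X).
  rewrite mulmxBr !mulmxBl !mul1mx -!scalemxAl Prho !raddfB /= !linearZ /= tr1.
  by ring.
rewrite lerDl; case: hX => m [v [vk ->]].
(* By cyclicity, each rank-one term of [X] contributes the value of the form 1 - 2P at its
   vector. *)
rewrite mulmx_sumr raddf_sum /= sumr_ge0// => j _.
by rewrite mulmxA mxtrace_mulC mulmxA trace_mx11 hv.
Qed.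

Lemma exists_trnorm_sub_lt1 n (rho P : 'M[C]_n) (v : 'cV[C]_n) :
  mixed_state rho -> orthoproj_range P rho ->
  ~ (0 <= (v ^t* *m (1%:M - 2 *: P) *m v) 0 0) ->
  exists2 c : C, 0 <= c & trnorm (rho - c *: (v *m v ^t*)) < 1.
Proof.
move=> [[/hermsymmxP rhoH rho0] tr1] hP.
have [_ [Z PZ]] := orthoproj_range_factor hP; have [PP PH _] := hP.
move=> /(sub_outer_decomposition rhoH rho0 tr1 PP PH PZ)[c c0 [A [B]]].
case=> A0 B0 AB trAB; exists c => //.
rewrite AB -ltcR; apply: le_lt_trans (trnorm_sub_le A0 B0 _) trAB.
rewrite -AB; apply/hermsymmxP; rewrite adjmxB rhoH adjmxZ adjmxM trmxCK.
by rewrite conj_Creal// ger0_real.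
Qed.

End KCoherence.

Theorem theorem9 (R : realType) (n k : nat) (hk : (1 <= k)%N) (hkn : (k <= n)%N)
    (rho P : 'M[R[i]]_n) (hrho : mixed_state rho)
    (hP : orthoproj_range P rho) :
  coh_dist k rho = 1 <->
  (forall f : 'I_k -> 'I_n, {homo f : a b / (a < b)%N} ->
     opnorm (mxsub f f P) <= 1 / 2).
Proof.
rewrite coh_dist_eq1P//.
have PH : P ^t* = P by case: hP.
have P0 := orthoproj_nneg hP.
pose E (f : 'I_k -> 'I_n) : 'M[R[i]]_(n, k) := colsub f 1%:M.
have subE f : injective f -> E f ^t* *m (1%:M - 2 *: P) *m E f =
    1%:M - 2 *: mxsub f f P.
  move=> hf; rewrite mxsub_congr mulmxBr mulmxBl mulmx1 colsub1_isometry//.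
  by rewrite -scalemxAr -scalemxAl.
(* A block satisfies the norm bound exactly when the form 1 - 2P is nonnegative on vectors supported
   on its k coordinates. *)
have halfP (f : 'I_k -> 'I_n) : injective f -> opnorm (mxsub f f P) <= 1 / 2 <->
    nnegmx (E f ^t* *m (1%:M - 2 *: P) *m E f).
  move=> hf; rewrite subE//; apply: opnorm_le_halfP; rewrite mxsub_congr.
    by rewrite !adjmxM trmxCK PH mulmxA.
  exact: nnegmx_congr.
split=> [hX f /increasing_inj hf|hop X].
- apply/(halfP _ hf) => x; apply: contrapT => hx.
  have [|c c0] := exists_trnorm_sub_lt1 (v := E f *m x) hrho hP.
    by rewrite adjmxM !mulmxA; move: hx; rewrite !mulmxA.
  apply/negP; rewrite -leNgt; apply: hX.
  (* The factor [c] is absorbed into the vector through its square root, giving a one-term element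
     of the cone. *)
  exists 1%N, (fun=> sqrtC c *: (E f *m x)); split.
    move=> _; apply: leq_trans (nnz_colsub1 f x).
    apply/subset_leq_card/fintype.subsetP => i; rewrite !inE mxE.
    by apply: contraNneq => ->; rewrite mulr0.
  rewrite big_ord1 adjmxZ -scalemxAl -scalemxAr scalerA.
  by rewrite conj_Creal ?ger0_real ?sqrtC_ge0// -expr2 sqrtCK.
- apply: (trnorm_sub_coh_ge1 hrho hP) => v vk.
  (* The support of [v] fits into the coordinates of one block, and [v] is the image of its own
     restriction to them. *)
  have vk' : (#|finset (fun i => v i 0%R != 0%R)| <= k)%N by rewrite cardsE.
  have [f fhomo fv] := exists_increasing_cover vk' hkn.
  have hf := increasing_inj fhomo.
  have -> : v = E f *m rowsub f v.
    by rewrite colsub1_mul_restrict// => i vi; apply: fv; rewrite inE.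
  by have /(halfP _ hf)/(_ (rowsub f v)) := hop f fhomo; rewrite adjmxM !mulmxA.
Qed.
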